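(* Let $H_1$ and $H_2$ be orthomodular spaces and let $f \colon \mathbf P(H_1) \to \mathbf P(H_2)$ be a partial orthometry such that $(\ker f)^\perp$ has rank $\geq 3$. Then $f$ is induced by a partial quasiisometry from $H_1$ to $H_2$; that is, there is a partial quasiisometry $\phi\colon H_1\to H_2$ such that $f(\langle u\rangle)=\langle\phi(u)\rangle$ for all $u\in H_1$.
   Context: A sfield is a skew field (division ring). A $\ast$-sfield is a sfield $F$ with an involutory antiautomorphism $\ast \colon F \to F$. A Hermitian space over a $\ast$-sfield $F$ is a (left) linear space $H$ over $F$ with a map $(\cdot,\cdot)\colon H\times H\to F$ such that $(\alpha u+\beta v,w)=\alpha(u,w)+\beta(v,w)$, $(w,\alpha u+\beta v)=(w,u)\alpha^\ast+(w,v)\beta^\ast$, $(u,v)=(v,u)^\ast$ for all $u,v,w\in H$, $\alpha,\beta\in F$, and which is anisotropic: $(u,u)=0$ implies $u=0$. We write $u\perp v$ if $(u,v)=0$. Standing assumption: a Hermitian space contains at most countably many mutually orthogonal nonzero vectors. A linear subspace $S$ of $H$ is orthoclosed if $S=S^{\perp\perp}$, where $S^\perp=\{u\in H:u\perp v\text{ for all }v\in S\}$, and splitting if $H$ is the direct sum of $S$ and $S^\perp$. An orthomodular space is a Hermitian space in which every orthoclosed subspace is splitting. Subspaces carry the inherited Hermitian form. Let $H_1,H_2$ be over the sfields $F_1,F_2$. A map $\phi\colon H_1\to H_2$ is quasilinear with associated isomorphism $\sigma$ if it is additive and $\sigma\colon F_1\to F_2$ is an isomorphism of sfields with $\phi(\alpha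 u)=\alpha^\sigma\phi(u)$ for all $u\in H_1$, $\alpha\in F_1$. A bijection $\phi$ between Hermitian spaces over $F_1$ and $F_2$ is quasiunitary if it is quasilinear with associated isomorphism $\sigma$ and there is a $\lambda\in F_2\setminus\{0\}$ such that $(\phi(u),\phi(v))_2={(u,v)_1}^\sigma\,\lambda$ for all $u,v$. A partial quasiisometry between orthomodular spaces $H_1$, $H_2$ is a quasilinear map $\phi\colon H_1\to H_2$ for which there are orthoclosed subspaces $S_1$ of $H_1$ and $S_2$ of $H_2$ such that $\ker\phi=S_1^\perp$, $\operatorname{im}\phi=S_2$, and the restriction of $\phi$ to a map $S_1\to S_2$ is quasiunitary. An orthoset is a set $X$ with a symmetric binary relation $\perp$ and a constant $0$ such that $x\perp x$ if and only if $x=0$, and $0\perp x$ for all $x\in X$. Elements distinct from $0$ are proper. For $A\subseteq X$, $A^\perp=\{x\in X: x\perp y\text{ for all }y\in A\}$; a subspace of $X$ is a subset $A$ with $A=A^{\perp\perp}$, viewed as an orthoset with the inherited relation. The rank of an orthoset is the maximal size $n$ of a set of mutually orthogonal proper elements if such a finite maximum exists, and $\infty$ otherwise. An orthoset $X$ is a Dacey space if, whenever $A,B$ are subspaces of $X$ with $B\subseteq A$, $B$ is a subspace of the orthoset $A$. An orthoisomorphism is a bijection preserving $\perp$ in both directions. A map $f\colon X\to Y$ between orthosets is adjointable if there is a map $g\colon Y\to X$ such that for all $x\in X$, $y\in Y$: $f(x)\perp y$ if and only if $x\perp g(y)$; $\ker f=\{x\in X:f(x)=0\}$. An adjointable map $f\colon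 X\to Y$ between Dacey spaces is a partial orthometry if there are subspaces $A$ of $X$ and $B$ of $Y$ such that $f$ restricts to an orthoisomorphism between $A$ and $B$, and $f(x)=0$ for every $x\in A^\perp$. For a Hermitian space $H$, $\mathbf P(H)=\{\langle u\rangle: u\in H\}$ is the set of at most one-dimensional subspaces of $H$ ($\langle u\rangle$ denotes the linear span of $u$), viewed as an orthoset with $\langle u\rangle\perp\langle v\rangle$ if $u\perp v$ and with the zero subspace $\{0\}$ as the constant $0$. If $H$ is orthomodular, $\mathbf P(H)$ is a Dacey space. *)

(* Defs.v *)
From HB Require Import structures.
From mathcomp Require Import all_boot all_order all_algebra.
From mathcomp Require Import all_classical.

Set Implicit Arguments.
Unset Strict Implicit.
Unset Printing Implicit Defensive.

Import GRing.Theory.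
Local Open Scope classical_set_scope.
Local Open Scope card_scope.
Local Open Scope ring_scope.

HB.mixin Record isOrthoset X := {
  operp : X -> X -> Prop;
  ozero : X;
  operp_sym : forall x y, operp x y -> operp y x;
  operp_self : forall x, operp x x <-> x = ozero;
  operp0 : forall x, operp ozero x
}.

#[short(type="orthosetType")]
HB.structure Definition Orthoset := { X of isOrthoset X }.

Section Orthosets.
Variable X : orthosetType.
Implicit Types A B : set X.

Definition ocompl A : set X := [set x | forall y, A y -> operp x y].

Definition is_osubspace A := A = ocompl (ocompl A).

Lemma ocompl_anti A B : A `<=` B -> ocompl B `<=` ocompl A.
Proof. by move=> AB x Bx y /AB; exact: Bx. Qed.

Lemma sub_ocomplK A : A `<=` ocompl (ocompl A).
Proof. by move=> x Ax y; move/(_ x Ax)/operp_sym. Qed.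

Lemma ocompl_osubspace A : is_osubspace (ocompl A).
Proof.
apply/seteqP; split; first exact: sub_ocomplK.
exact/ocompl_anti/sub_ocomplK.
Qed.

Lemma ocompl0 A : ocompl A ozero.
Proof. by move=> y _; exact: operp0. Qed.

Record osubspace := OSubspace {
  osubspace_set :> set X;
  osubspaceP : is_osubspace osubspace_set }.

Definition ocompl_sub A : osubspace := OSubspace (ocompl_osubspace A).

Lemma osubspace0 (A : osubspace) : (A : set X) ozero.
Proof. by rewrite (osubspaceP A); exact: ocompl0. Qed.

Definition osub (A : osubspace) : Type := {x : X | (A : set X) x}.

End Orthosets.

Section SubOrthoset.
Variables (X : orthosetType) (A : osubspace X).

Definition osub_perp (x y : osub A) := operp (sval x) (sval y).
Definition osub_zero : osub A := exist _ ozero (osubspace0 A).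

Lemma osub_perp_sym x y : osub_perp x y -> osub_perp y x.
Proof. exact: operp_sym. Qed.

Lemma osub_perp_self x : osub_perp x x <-> x = osub_zero.
Proof.
split=> [/operp_self x0|->]; last exact/operp_self.
by apply: eq_sig_hprop => // y p q; exact: Prop_irrelevance.
Qed.

Lemma osub_perp0 x : osub_perp osub_zero x.
Proof. exact: operp0. Qed.

HB.instance Definition _ :=
  isOrthoset.Build (osub A) osub_perp_sym osub_perp_self osub_perp0.

End SubOrthoset.

Section Rank.
Variable X : orthosetType.

Definition has_orthogonal_family (n : nat) := exists A : set X,
  [/\ A #= `I_n,
      forall x, A x -> x <> ozero &
      forall x y, A x -> A y -> x <> y -> operp x y].

Definition is_max_orthogonal_size (n : nat) := has_orthogonal_family n /\
  forall m, has_orthogonal_family m -> (m <= n)%N.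

(* [None] stands for infinite rank. *)
Definition rank : option nat :=
  if pselect (exists n, is_max_orthogonal_size n) is left _
  then Some (xget 0%N is_max_orthogonal_size) else None.

End Rank.

Definition leq_rank (n : nat) (r : option nat) : Prop :=
  if r is Some m then (n <= m)%N else True.

HB.mixin Record Orthoset_isDacey X of Orthoset X := {
  daceyP : forall A B : osubspace X, (B : set X) `<=` A ->
    is_osubspace [set x : osub A | (B : set X) (sval x)]
}.

#[short(type="daceyType")]
HB.structure Definition Dacey := { X of Orthoset X & Orthoset_isDacey X }.

Section OrthosetMaps.
Variables X Y : orthosetType.
Implicit Type f : X -> Y.

Definition adjointable f := exists g : Y -> X,
  forall x y, operp (f x) y <-> operp x (g y).

Definition oker f : set X := [set x | f x = ozero].

Definition orthoisomorphism_between (A : set X) (B : set Y) f :=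
  set_bij A B f /\
  forall x y, A x -> A y -> (operp x y <-> operp (f x) (f y)).

End OrthosetMaps.

Definition partial_orthometry (X Y : daceyType) (f : X -> Y) :=
  adjointable f /\
  exists (A : osubspace X) (B : osubspace Y),
    orthoisomorphism_between A B f /\
    forall x, ocompl A x -> f x = ozero.

HB.mixin Record UnitRing_isSfield F of GRing.UnitRing F := {
  sfield_unit : forall a : F, a != 0 -> a \is a GRing.unit
}.

#[short(type="sfieldType")]
HB.structure Definition Sfield :=
  { F of GRing.UnitRing F & UnitRing_isSfield F }.

HB.mixin Record Sfield_isStarSfield F of Sfield F := {
  star : F -> F;
  starD : forall a b, star (a + b) = star a + star b;
  starM : forall a b, star (a * b) = star b * star a;
  starK : involutive star
}.

#[short(type="starSfieldType")]
HB.structure Definition StarSfield :=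
  { F of Sfield F & Sfield_isStarSfield F }.

(* MathComp's [{hermitian _ for _ & _}] puts the twisted scalar of the second *)
(* argument on the left, which is not the right law when [F] is               *)
(* noncommutative; here it is on the right. The field [hform_countable]       *)
(* makes countable orthogonal dimension part of the notion.                   *)
HB.mixin Record Lmodule_isHermitianSpace (F : starSfieldType) H
    of GRing.Lmodule F H := {
  hform : H -> H -> F;
  hformDl : forall a b u v w,
    hform (a *: u + b *: v) w = a * hform u w + b * hform v w;
  hformDr : forall a b u v w,
    hform w (a *: u + b *: v) = hform w u * star a + hform w v * star b;
  hform_star : forall u v, hform u v = star (hform v u);
  hform_aniso : forall u, hform u u = 0 -> u = 0;
  hform_countable : forall A : set H,
    (forall u, A u -> u <> 0) ->
    (forall u v, A u -> A v -> u <> v -> hform u v = 0) ->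
    countable A
}.

#[short(type="hermitianSpaceType")]
HB.structure Definition HermitianSpace (F : starSfieldType) :=
  { H of GRing.Lmodule F H & Lmodule_isHermitianSpace F H }.

Section HermitianSpaces.
Variables (F : starSfieldType) (H : hermitianSpaceType F).
Implicit Types (u v w : H) (S : set H).

Definition hperp u v := hform u v = 0.

Definition hcompl S : set H := [set u | forall v, S v -> hperp u v].

Definition linear_subspace S :=
  S 0 /\ forall a b u v, S u -> S v -> S (a *: u + b *: v).

Definition orthoclosed S := linear_subspace S /\ S = hcompl (hcompl S).

Definition splitting S := linear_subspace S /\
  forall w, exists! uv : H * H,
    [/\ S uv.1, hcompl S uv.2 & w = uv.1 + uv.2].

Lemma star0 : star (0 : F) = 0.
Proof. by apply: (addrI (star 0)); rewrite -starD !addr0. Qed.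

Lemma hform0l v : hform (0 : H) v = 0.
Proof. by have := hformDl 0 0 0 0 v; rewrite !scale0r !mul0r !addr0. Qed.

Lemma hformZl a u v : hform (a *: u) v = a * hform u v.
Proof. by have := hformDl a 0 u 0 v; rewrite scale0r mul0r !addr0. Qed.

Lemma hformBl u v w : hform (u - v) w = hform u w - hform v w.
Proof.
by have := hformDl 1 (-1) u v w; rewrite !scale1r scaleN1r mul1r mulN1r.
Qed.

Lemma hperp_sym u v : hperp u v -> hperp v u.
Proof. by rewrite /hperp => uv; rewrite hform_star uv star0. Qed.

Lemma hperpZl a u v : hperp u v -> hperp (a *: u) v.
Proof. by rewrite /hperp hformZl => ->; rewrite mulr0. Qed.

Lemma hperpZ a b u v : hperp u v -> hperp (a *: u) (b *: v).
Proof. by move=> uv; apply/hperpZl/hperp_sym/hperpZl/hperp_sym. Qed.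

Lemma hcompl_linear S : linear_subspace (hcompl S).
Proof.
split=> [v _|a b u v Su Sv w Sw]; first exact: hform0l.
by rewrite /hperp hformDl (Su w Sw) (Sv w Sw) !mulr0 addr0.
Qed.

Definition hspan u : set H := [set a *: u | a in [set: F]].

Record projspace := Proj {
  proj_set :> set H;
  projP : exists u, proj_set = hspan u }.

Definition pspan u : projspace :=
  Proj (ex_intro (fun v => hspan u = hspan v) u erefl).

Definition proj_perp (p q : projspace) :=
  exists u v, [/\ p = pspan u, q = pspan v & hperp u v].

Lemma proj_inj (p q : projspace) : (p : set H) = q -> p = q.
Proof.
case: p q => [p Pp] [q Pq] /= epq; case: _ / epq in Pq *.
by congr Proj; exact: Prop_irrelevance.
Qed.

Lemma projE (p : projspace) : exists u, p = pspan u.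
Proof. by case: (projP p) => u pu; exists u; exact: proj_inj. Qed.

Lemma pspan_mem u v : pspan u = pspan v -> exists a, u = a *: v.
Proof.
move=> /(congr1 proj_set) /= uv.
have: hspan u u by exists 1; rewrite ?scale1r.
by rewrite uv => -[a _ <-]; exists a.
Qed.

Lemma proj_perpE u v : proj_perp (pspan u) (pspan v) <-> hperp u v.
Proof.
split=> [[u' [v' [/pspan_mem[a ->] /pspan_mem[b ->] uv]]]|uv].
  exact: hperpZ.
by exists u, v.
Qed.

Lemma proj_perp_sym p q : proj_perp p q -> proj_perp q p.
Proof. by move=> [u [v [-> -> /hperp_sym vu]]]; exists v, u. Qed.

Lemma proj_perp_self p : proj_perp p p <-> p = pspan 0.
Proof.
have [u ->] := projE p; rewrite proj_perpE; split=> [/hform_aniso -> //|].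
by move=> /pspan_mem[a ->]; rewrite scaler0; exact: hform0l.
Qed.

Lemma proj_perp0 p : proj_perp (pspan 0) p.
Proof. by have [u ->] := projE p; apply/proj_perpE; exact: hform0l. Qed.

HB.instance Definition _ :=
  isOrthoset.Build projspace proj_perp_sym proj_perp_self proj_perp0.

Lemma pspan_ocompl (A : set projspace) :
  [set u | ocompl A (pspan u)] = hcompl [set u | A (pspan u)].
Proof.
apply/seteqP; split=> u /= Au; first by move=> v /= /Au /proj_perpE.
by move=> q; have [v ->] := projE q => /Au /proj_perpE.
Qed.

Lemma osubspace_orthoclosed (A : osubspace projspace) :
  orthoclosed [set u | (A : set projspace) (pspan u)].
Proof.
have E : [set u | (A : set projspace) (pspan u)] =
    hcompl (hcompl [set u | (A : set projspace) (pspan u)]).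
  by rewrite -!pspan_ocompl -(osubspaceP A).
by split=> //; rewrite E; exact: hcompl_linear.
Qed.

End HermitianSpaces.

HB.mixin Record HermitianSpace_isOrthomodular (F : starSfieldType) H
    of HermitianSpace F H := {
  orthomodularP : forall S : set H, orthoclosed S -> splitting S
}.

#[short(type="orthomodularType")]
HB.structure Definition Orthomodular (F : starSfieldType) :=
  { H of HermitianSpace F H & HermitianSpace_isOrthomodular F H }.

Section OrthomodularDacey.
Variables (F : starSfieldType) (H : orthomodularType F).

Lemma proj_dacey (A B : osubspace (projspace H)) :
    (B : set (projspace H)) `<=` A ->
  is_osubspace [set x : osub A | (B : set (projspace H)) (sval x)].
Proof.
move=> BA; apply/seteqP; split; first exact: sub_ocomplK.
case=> p Ap /= Bp; have [u pu] := projE p; subst p.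
have [_ Aop] := osubspace_orthoclosed A.
have [Alin _] := osubspace_orthoclosed A.
have [_ /(_ u)[[v w] [/= [Bv Bw uvw] _]]] :=
  orthomodularP _ (osubspace_orthoclosed B).
have wE : w = 1 *: u + (-1) *: v by rewrite scale1r scaleN1r uvw addrC addKr.
have Aw : (A : set (projspace H)) (pspan w).
  by rewrite wE; apply: (proj2 Alin) => //; exact: BA.
have uw : hperp u w.
  apply/proj_perpE; apply: (Bp (exist _ (pspan w) Aw)) => -[q Aq] /=.
  have [z qz] := projE q; subst q => Bz.
  by apply/proj_perpE; exact: Bw.
have /hform_aniso w0 : hform w w = 0.
  rewrite {1}wE scale1r scaleN1r hformBl uw.
  by rewrite (hperp_sym (Bw _ Bv)) subrr.
by rewrite uvw w0 addr0.
Qed.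

HB.instance Definition _ := Orthoset_isDacey.Build (projspace H) proj_dacey.

End OrthomodularDacey.

Section Quasilinear.
Variables (F1 F2 : starSfieldType).

Definition quasilinear (V1 : lmodType F1) (V2 : lmodType F2)
    (sigma : {rmorphism F1 -> F2}) (phi : V1 -> V2) :=
  [/\ bijective sigma,
      forall u v, phi (u + v) = phi u + phi v &
      forall a u, phi (a *: u) = sigma a *: phi u].

(* The restriction of [phi], quasilinear with associated isomorphism [sigma], *)
(* to a map from [S1] to [S2] is quasiunitary.                                *)
Definition quasiunitary_between
    (H1 : hermitianSpaceType F1) (H2 : hermitianSpaceType F2)
    (S1 : set H1) (S2 : set H2) (sigma : {rmorphism F1 -> F2})
    (phi : H1 -> H2) :=
  set_bij S1 S2 phi /\
  exists2 lambda : F2, lambda != 0 &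
    forall u v, S1 u -> S1 v ->
      hform (phi u) (phi v) = sigma (hform u v) * lambda.

Definition partial_quasiisometry
    (H1 : orthomodularType F1) (H2 : orthomodularType F2) (phi : H1 -> H2) :=
  exists2 sigma : {rmorphism F1 -> F2}, quasilinear sigma phi &
  exists (S1 : set H1) (S2 : set H2),
    [/\ orthoclosed S1 /\ orthoclosed S2,
        [set u | phi u = 0] = hcompl S1,
        range phi = S2 &
        quasiunitary_between S1 S2 sigma phi].

End Quasilinear.

(* Main.v *)
(* Since [f] has an adjoint, [f <u + v>] lies in the span of [f <u>] and      *)
(* [f <v>]; its kernel is the orthocomplement of the subspace on which it is  *)
(* an orthoisomorphism. That subspace contains nonzero orthogonal [e1], [e2], *)
(* [e3]. Fix a generator [phi e1] of [f <e1>]; for [x] orthogonal to [e1]     *)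
(* the line [f <x>] has a unique vector [phi x] with                          *)
(* [f <e1 + x> = <phi e1 + phi x>]. As in the fundamental theorem of          *)
(* projective geometry, a third independent vector shows that [phi] is        *)
(* additive and that its scalar map [sigma] does not depend on [x].           *)
(* Preservation of orthogonality makes [sigma] surjective, and the factor     *)
(* [sigma (v, v)^-1 (phi v, phi v)] takes the same value at orthogonal [v]    *)
(* and [w] (compare both with [v + w]); since some nonzero [z] is orthogonal  *)
(* to both [v] and [e1], it is constant.                                      *)

Require Import Defs.
From HB Require Import structures.
From mathcomp Require Import all_boot all_order all_algebra.
From mathcomp Require Import all_classical.

Set Implicit Arguments.
Unset Strict Implicit.
Unset Printing Implicit Defensive.

Import GRing.Theory.
Local Open Scope classical_set_scope.
Local Open Scope ring_scope.

(** The adjoint [g] makes [f] respect collinearity: if [t] is orthogonal to the images of [u] and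
    [v], then [g t] is orthogonal to [u + v], and by [hperp_span2] a span of two vectors equals its
    double orthocomplement. In the same way [f] ignores components orthogonal to [A]
    ([orthometry_proj]), so [f] preserves and reflects orthogonality to vectors of [A]
    ([orthometry_perp]).

    The rank hypothesis yields an orthogonal triple in [A]. This feeds a version of the fundamental
    theorem of projective geometry that allows a kernel, [projective_map_semilinear]: image vectors
    are normalised against one vector [e], and two more vectors with nonzero orthogonal images
    provide the independence that the classical argument takes from the dimension.

    The resulting [sigma] is at first only a ring morphism. It is onto because [f] maps onto [B]
    ([scalar_map_surj]), and orthogonality forces a single factor [lambda]
    ([scale_factor_const]). *)

(** * Linear independence over a skew field *)

Section SfieldModules.
Variables (F : sfieldType) (V : lmodType F).
Implicit Types (a b : F) (u v : V).

Lemma sfield_mulVr a : a != 0 -> a^-1 * a = 1.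
Proof. by move=> /sfield_unit; exact: mulVr. Qed.

Lemma sfield_scalerI a u v : a != 0 -> a *: u = a *: v -> u = v.
Proof.
by move=> a0 /(congr1 ( *:%R a^-1)); rewrite !scalerA sfield_mulVr // !scale1r.
Qed.

Lemma sfield_scaler_eq0 a u : u <> 0 -> a *: u = 0 -> a = 0.
Proof.
move=> u0 au0; apply/eqP/negPn/negP => a0; apply: u0.
by apply: (sfield_scalerI a0); rewrite scaler0.
Qed.

Lemma sfield_scalerIl a b u : u <> 0 -> a *: u = b *: u -> a = b.
Proof.
move=> u0 /eqP; rewrite -subr_eq0 -scalerBl => /eqP.
by move/(sfield_scaler_eq0 u0)/eqP; rewrite subr_eq0 => /eqP.
Qed.

Definition lindep2 u v := forall a b, a *: u + b *: v = 0 -> a = 0 /\ b = 0.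

Lemma lindep2I u v a b a' b' : lindep2 u v ->
  a *: u + b *: v = a' *: u + b' *: v -> a = a' /\ b = b'.
Proof.
move=> uv /eqP; rewrite -subr_eq0 opprD addrACA -!scalerBl => /eqP/uv.
by case=> /eqP + /eqP; rewrite !subr_eq0 => /eqP-> /eqP->.
Qed.

Lemma lindep2P u v : u <> 0 -> (forall c, v <> c *: u) -> lindep2 u v.
Proof.
move=> u0 uv a b e.
have b0 : b = 0.
  apply/eqP/negPn/negP => b0; apply: (uv (- (b^-1 * a))).
  apply: (sfield_scalerI b0); rewrite scaleNr scalerN scalerA mulrA.
  by rewrite mulrV ?sfield_unit // mul1r; apply/eqP; rewrite -addr_eq0 addrC e.
by move: e; rewrite b0 scale0r addr0 => /(sfield_scaler_eq0 u0).
Qed.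

Lemma lindep2C u v : lindep2 u v -> lindep2 v u.
Proof. by move=> uv a b; rewrite addrC => /uv[-> ->]. Qed.

Lemma lindep2Zl c u v : c *: u <> 0 -> lindep2 u v -> lindep2 (c *: u) v.
Proof.
move=> cu0 uv a b; rewrite scalerA => /uv[ac0 ->]; split=> //.
by apply: (sfield_scaler_eq0 cu0); rewrite scalerA ac0 scale0r.
Qed.

End SfieldModules.

(** * Orthogonal projection and spans in Hermitian spaces *)

Section Hermitian.
Variables (F : starSfieldType) (H : hermitianSpaceType F).
Implicit Types (u v w t : H) (a b c : F).

Lemma hformDl1 u v w : hform (u + v) w = hform u w + hform v w.
Proof. by have := hformDl 1 1 u v w; rewrite !scale1r !mul1r. Qed.

Lemma hformDr1 u v w : hform w (u + v) = hform w u + hform w v.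
Proof.
have star1 : star (1 : F) = 1.
  by have := starM (1 : F) (star 1); rewrite mul1r starK mul1r.
by have := hformDr 1 1 u v w; rewrite !scale1r star1 !mulr1.
Qed.

Lemma hperpC u v : hperp u v <-> hperp v u.
Proof. by split; exact: hperp_sym. Qed.

Lemma hperp0l u : hperp 0 u.
Proof. exact: hform0l. Qed.

Lemma hperpDl u v w : hperp u w -> hperp v w -> hperp (u + v) w.
Proof. by rewrite /hperp hformDl1 => -> ->; rewrite addr0. Qed.

Lemma hform_neq0 u : u <> 0 -> hform u u != 0.
Proof. by move=> u0; apply/eqP => /hform_aniso. Qed.

(** The coefficient of the orthogonal projection of [w] onto the line of [u]; it is 0 when
    [u = 0]. *)
Definition hcoef w u : F := hform w u / hform u u.

Lemma hcoefD v w u : hcoef (v + w) u = hcoef v u + hcoef w u.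
Proof. by rewrite /hcoef hformDl1 mulrDl. Qed.

Lemma hcoefZ a w u : hcoef (a *: w) u = a * hcoef w u.
Proof. by rewrite /hcoef hformZl mulrA. Qed.

Lemma hperp_hcoef w u : hperp (w - hcoef w u *: u) u.
Proof.
have [->|/eqP/hform_neq0 u0] := eqVneq u 0.
  by apply: hperp_sym; exact: hperp0l.
by rewrite /hperp hformBl hformZl /hcoef mulrVK ?subrr// sfield_unit.
Qed.

(** Gram-Schmidt: the residue [w2] of [w] modulo [u] and [v] is orthogonal to both, hence by
    hypothesis to [w], hence to itself, and anisotropy makes it vanish. *)
Lemma hperp_span2 u v w :
    (forall t, hperp u t -> hperp v t -> hperp w t) ->
  exists a b, w = a *: u + b *: v.
Proof.
pose v' := v - hcoef v u *: u.
pose w1 := w - hcoef w u *: u; pose w2 := w1 - hcoef w1 v' *: v'.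
move=> /(_ w2) uvw; exists (hcoef w u - hcoef w1 v' * hcoef v u), (hcoef w1 v').
have w2v' : hperp w2 v' by exact: hperp_hcoef.
have v'u : hperp v' u by exact: hperp_hcoef.
have w2u : hperp w2 u.
  rewrite /w2 -scaleNr; apply: hperpDl; first exact: hperp_hcoef.
  exact: hperpZl.
have w2v : hperp w2 v.
  apply/hperpC; rewrite -[v](subrK (hcoef v u *: u)) -/v'.
  by apply: hperpDl; [exact/hperpC | exact/hperpZl/hperpC].
have w2E : w2 = w - (hcoef w u *: u + hcoef w1 v' *: v').
  by rewrite /w2 /w1 opprD addrA.
have : hperp w2 w2.
  rewrite {1}w2E -[- _]scaleN1r; apply: hperpDl.
    by apply: uvw; exact/hperpC.
  by apply/hperpZl/hperpDl; apply/hperpZl/hperpC.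
move/hform_aniso/eqP; rewrite w2E subr_eq0 => /eqP {1}->.
by rewrite {2}/v' scalerBr scalerA scalerBl -addrA [- _ + _]addrC.
Qed.

Lemma pspanP u v : pspan u = pspan v <-> exists2 c, c != 0 & u = c *: v.
Proof.
split=> [uv|[c c0 ->]].
  have [c uE] := pspan_mem uv; have [v0|v0] := pselect (v = 0).
    by exists 1; rewrite ?oner_neq0 // uE v0 !scaler0.
  exists c => //; apply/eqP => c0; apply: v0.
  by have [d ->] := pspan_mem (esym uv); rewrite uE c0 scale0r scaler0.
apply/proj_inj/seteqP; split=> _ /= [a _ <-].
  by exists (a * c); rewrite ?scalerA.
by exists (a / c) => //; rewrite scalerA mulrVK // sfield_unit.
Qed.

Lemma pspanZ a u : a != 0 -> pspan (a *: u) = pspan u.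
Proof. by move=> a0; apply/pspanP; exists a. Qed.

Lemma pspan_eq0 u : pspan u = pspan 0 <-> u = 0.
Proof. by split=> [/pspan_mem[a ->]|->//]; rewrite scaler0. Qed.

Lemma ocompl1_inj (p q : projspace H) :
  (forall r, operp p r <-> operp q r) -> p = q.
Proof.
have [[u ->] [v ->]] := (projE p, projE q) => pq.
have huv t : hperp u t <-> hperp v t.
  by rewrite -2!proj_perpE; exact: pq.
have [a [b]] : exists a b, v = a *: u + b *: 0.
  by apply: hperp_span2 => t /huv.
have [c [d]] : exists a b, u = a *: v + b *: 0.
  by apply: hperp_span2 => t /huv.
rewrite !scaler0 !addr0 => uE vE; apply/pspanP.
have [v0|v0] := pselect (v = 0).
  by exists 1; rewrite ?oner_neq0 // uE v0 !scaler0.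
exists c => //; apply/eqP => c0; apply: v0.
by rewrite vE uE c0 scale0r scaler0.
Qed.

End Hermitian.

(** * A fundamental theorem of projective geometry for maps with a kernel *)

Section FundamentalTheorem.
Variables (F1 F2 : starSfieldType).
Variables (H1 : hermitianSpaceType F1) (H2 : hermitianSpaceType F2).
Variables (r : H1 -> H2) (e y0 z0 : H1).
Hypothesis r0 : r 0 = 0.
Hypothesis rZ : forall a u, a != 0 -> pspan (r (a *: u)) = pspan (r u).
Hypothesis rD : forall u v, exists a b, r (u + v) = a *: r u + b *: r v.
Hypothesis re : r e <> 0.
Hypothesis r_perp : forall x, hperp x e -> hperp (r x) (r e).
Hypotheses (y0e : hperp y0 e) (ry0 : r y0 <> 0).
Hypotheses (z0e : hperp z0 e) (rz0 : r z0 <> 0).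
Hypothesis ry0z0 : hperp (r y0) (r z0).

Let rD_span x y p q : pspan p = pspan (r x) -> pspan q = pspan (r y) ->
  exists a b, r (x + y) = a *: p + b *: q.
Proof.
move=> /esym/pspan_mem[c xp] /esym/pspan_mem[d yq].
have [a [b ->]] := rD x y.
by exists (a * c), (b * d); rewrite xp yq !scalerA.
Qed.

Let rN u : pspan (r (- u)) = pspan (r u).
Proof. by rewrite -scaleN1r rZ // oppr_eq0 oner_neq0. Qed.

Let rB_span x y p q : pspan p = pspan (r x) -> pspan q = pspan (r y) ->
  exists a b, r (x - y) = a *: p + b *: q.
Proof. by move=> px; rewrite -rN; exact: rD_span. Qed.

(** As [v = (u + v) - u] and [r u = 0], each of the two image vectors is a multiple of the other. *)
Let rD_ker u v : r u = 0 -> pspan (r (u + v)) = pspan (r v).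
Proof.
move=> u0; apply/pspanP.
have [a [b]] := rD u v; rewrite u0 scaler0 add0r => uvE.
have [c [d]] := rB_span (erefl (pspan (r (u + v)))) (erefl (pspan (r u))).
rewrite u0 scaler0 addr0 addrAC subrr add0r => vE.
(* For [b = 0] both vectors vanish, so the coefficient 1 serves. *)
have [b0|b0] := eqVneq b 0; last by exists b.
exists 1; first exact: oner_neq0.
by rewrite vE uvE b0 scale0r !scaler0.
Qed.

(* [r] picks representatives of the image lines; [p] is the rescaling of      *)
(* [r x] that is compatible with [r e].                                       *)
Definition lift x p :=
  pspan p = pspan (r x) /\ pspan (r (e + x)) = pspan (r e + p).

Lemma lift_perp x p : hperp x e -> lift x p -> hperp p (r e).
Proof. by move=> /r_perp xe [/pspan_mem[c ->] _]; exact: hperpZl. Qed.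

Let form_e a p : hperp p (r e) ->
  hform (a *: r e + p) (r e) = a * hform (r e) (r e).
Proof. by rewrite /hperp hformDl1 hformZl => ->; rewrite addr0. Qed.

Let form_eI a b p q : hperp p (r e) -> hperp q (r e) ->
  a *: r e + p = b *: r e + q -> a = b /\ p = q.
Proof.
move=> pe qe E; have := congr1 (fun u => hform u (r e)) E.
rewrite !form_e // => /mulIr ab; have {}ab : a = b.
  by apply/ab/sfield_unit/hform_neq0.
by split=> //; move: E; rewrite ab => /addrI.
Qed.

Let re_notin a p : hperp p (r e) -> r e <> a *: p.
Proof.
move=> pe E; apply: re; apply: hform_aniso.
by rewrite {1}E; exact: hperpZl.
Qed.

(** Proportional vectors with the same component 1 along [r e] are equal. *)
Lemma lift_inj x p q : hperp x e -> lift x p -> lift x q -> p = q.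
Proof.
move=> xe px qx; have [pe qe] := (lift_perp xe px, lift_perp xe qx).
have : pspan (r e + p) = pspan (r e + q) by rewrite -(proj2 px) (proj2 qx).
case/pspan_mem => c; rewrite -{1}[r e]scale1r scalerDr => E.
have [] := form_eI _ _ E; rewrite //; first exact: hperpZl.
by move=> <-; rewrite scale1r.
Qed.

Lemma lift_eq0 x : r x = 0 -> lift x 0.
Proof.
by move=> x0; split; [rewrite x0 | rewrite addrC rD_ker // addr0].
Qed.

(** In [r (e + x) = a *: r e + b *: r x] neither coefficient vanishes: [a = 0] would put [r e] on
    the line of [r x], and [b = 0] would put [r x] on the line of [r e]. Dividing by [a] gives the
    lift. *)
Lemma lift_exists x : hperp x e -> exists p, lift x p.
Proof.
move=> xe; have [rx0|rx0] := pselect (r x = 0).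
  by exists 0; exact: lift_eq0.
have rxe := r_perp xe; have [a [b E]] := rD e x.
have a0 : a != 0.
  apply/eqP => a0; move: E; rewrite a0 scale0r add0r => E.
  have [c [d]] := rB_span (erefl (pspan (r (e + x)))) (erefl (pspan (r x))).
  by rewrite addrK E scalerA -scalerDl; exact: re_notin.
have b0 : b != 0.
  apply/eqP => b0; move: E; rewrite b0 scale0r addr0 => E.
  have [c [d]] := rB_span (erefl (pspan (r (e + x)))) (erefl (pspan (r e))).
  rewrite addrC addKr E scalerA -scalerDl => xE.
  by apply: rx0; apply: hform_aniso; rewrite {1}xE; exact/hperpZl/hperp_sym.
exists ((a^-1 * b) *: r x); split.
  rewrite pspanZ // mulrI_eq0 //; apply: mulrI.
  by rewrite unitrV sfield_unit.
apply/pspanP; exists a => //.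
by rewrite E scalerDr scalerA mulVKr // sfield_unit.
Qed.

(** The vector [r (e + x + y)] is expanded through [(e + x) + y] and through [(e + y) + x];
    independence of [p] and [q] forces all coefficients to agree. *)
Lemma lift_add_indep x y p q : hperp x e -> hperp y e ->
  lift x p -> lift y q -> lindep2 p q -> lift (x + y) (p + q).
Proof.
move=> xe ye px qy pq.
have [pe qe] := (lift_perp xe px, lift_perp ye qy).
have xye : hperp (x + y) e by exact: hperpDl.
have [a [b E]] := rD_span (esym (proj2 px)) (proj1 qy).
have [a' [b' E']] := rD_span (esym (proj2 qy)) (proj1 px).
rewrite -addrA scalerDr -addrA in E.
rewrite -addrA [y + x]addrC scalerDr -addrA in E'.
have [|||aa' pqE] := @form_eI a a' (a *: p + b *: q) (a' *: q + b' *: p).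
- by apply: hperpDl; exact: hperpZl.
- by apply: hperpDl; exact: hperpZl.
- by rewrite -E E'.
have [ab' ba'] : a = b' /\ b = a'.
  by apply: (lindep2I pq); rewrite pqE addrC.
have {E'} E : r (e + (x + y)) = a *: (r e + (p + q)).
  by rewrite E !scalerDr ba' aa'.
have a0 : a != 0.
  apply/eqP => a0; move: E; rewrite a0 scale0r => exy0.
  have [c [d]] := rB_span (erefl (pspan (r (e + (x + y)))))
    (erefl (pspan (r (x + y)))).
  by rewrite exy0 scaler0 add0r addrK; exact/re_notin/r_perp.
have spanE : pspan (r (e + (x + y))) = pspan (r e + (p + q)).
  by rewrite E pspanZ.
split=> //.
(* Comparing the parts orthogonal to [r e] shows that [p + q] is a multiple of [r (x + y)], a
   nonzero one because [p] and [q] are independent. *)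
have [s [t]] := rD_span (erefl (pspan (r e))) (erefl (pspan (r (x + y)))).
rewrite E => /(congr1 ( *:%R a^-1)).
rewrite !scalerA sfield_mulVr // scale1r scalerDr !scalerA.
rewrite -[in LHS](scale1r (r e)).
case/form_eI => [||_ pqE'].
- exact: hperpDl.
- exact/hperpZl/r_perp.
apply/pspanP; exists (a^-1 * t) => //; apply/eqP => t0.
move: pqE'; rewrite t0 scale0r -[p]scale1r -[q]scale1r => /pq[/eqP].
by rewrite oner_eq0.
Qed.

(** The line of [p] cannot contain both [r y0] and [r z0], which are nonzero and orthogonal. *)
Lemma exists_lift_indep p : p <> 0 ->
  exists z t, [/\ hperp z e, lift z t & lindep2 p t].
Proof.
move=> p0.
have [y0p|/asboolPn y0p] := pselect (forall c, r y0 <> c *: p).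
  have [t ty] := lift_exists y0e; exists y0, t; split=> //.
  apply: lindep2P => // c tE; have [d ryE] := pspan_mem (esym (proj1 ty)).
  by apply: (y0p (d * c)); rewrite ryE tE scalerA.
have [t tz] := lift_exists z0e; exists z0, t; split=> //.
apply: lindep2P => // c tE; have [d rzE] := pspan_mem (esym (proj1 tz)).
move: y0p => /asboolP/existsNP[c' /contrapT ryE].
rewrite tE scalerA in rzE.
have dc0 : d * c != 0.
  by apply/eqP => dc0; apply: rz0; rewrite rzE dc0 scale0r.
apply: ry0; apply: hform_aniso; rewrite {2}ryE.
have -> : c' *: p = (c' / (d * c)) *: r z0.
  by rewrite rzE scalerA mulrVK // sfield_unit.
by apply/hperp_sym/hperpZl/hperp_sym.
Qed.

Lemma lift_add x y p q : hperp x e -> hperp y e ->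
  lift x p -> lift y q -> lift (x + y) (p + q).
Proof.
have ker u v s t : lift u s -> lift v t -> s = 0 -> lift (u + v) (s + t).
  move=> [su _] [tv tv'] s0; rewrite s0 in su *.
  have ru : r u = 0 by apply/pspan_eq0; rewrite -su.
  split; rewrite add0r; first by rewrite rD_ker.
  by rewrite addrCA rD_ker.
move=> xe ye px qy.
have [p0|p0] := pselect (p = 0); first exact: ker.
have [q0|q0] := pselect (q = 0).
  by rewrite addrC [p + q]addrC; exact: ker.
have [pq|] := pselect (forall c, q <> c *: p).
  by apply: lift_add_indep => //; exact: lindep2P.
move=> /existsNP[c /contrapT qE].
(* When [p] and [q] are proportional, an auxiliary [z] with independent lift [t] is added:
   [x + y + z] has the lifts [s + t] and [p + (q + t)], and [t] cancels. *)
have [z [t [ze tz pt]]] := exists_lift_indep p0.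
have xye : hperp (x + y) e by exact: hperpDl.
have yze : hperp (y + z) e by exact: hperpDl.
have qt : lindep2 q t by rewrite qE; apply: lindep2Zl; rewrite -?qE.
have pqt : lindep2 p (q + t).
  move=> a b; rewrite qE scalerDr addrA scalerA -scalerDl => /pt[+ b0].
  by rewrite b0 mul0r addr0.
have [s sxy] := lift_exists xye.
have [d sE] : exists d, s = d *: p.
  have [d ->] := pspan_mem (proj1 sxy).
  have [a [b ->]] := rD_span (proj1 px) (proj1 qy).
  by exists (d * (a + b * c)); rewrite qE scalerA -scalerDl scalerA.
have stz : lift (x + y + z) (s + t).
  have [s0|s0] := pselect (s = 0); first exact: ker.
  by apply: lift_add_indep => //; rewrite sE; apply: lindep2Zl; rewrite -?sE.
have pqtz : lift (x + y + z) (p + (q + t)).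
  by rewrite -addrA; apply: lift_add_indep => //; exact: lift_add_indep.
have : s + t = p + (q + t) by apply: lift_inj stz pqtz; exact: hperpDl.
by rewrite addrA => /addIr <-.
Qed.

Lemma lift_scale_exists a x p : hperp x e -> lift x p ->
  exists s, lift (a *: x) (s *: p).
Proof.
move=> xe px; have [->|a0] := eqVneq a 0.
  by exists 0; rewrite !scale0r; exact: lift_eq0.
have [q qx] := lift_exists (hperpZl a xe).
have [s qE] : exists s, q = s *: p.
  by apply: pspan_mem; rewrite (proj1 px) (proj1 qx) rZ.
by exists s; rewrite -qE.
Qed.

(** The lift of [a *: (x + y)] is computed from its summands and as a multiple of [p + q];
    independence equates the scalars. *)
Lemma lift_scale_transfer a s x y p q : hperp x e -> hperp y e ->
  lift x p -> lift y q -> lindep2 p q ->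
  lift (a *: x) (s *: p) -> lift (a *: y) (s *: q).
Proof.
move=> xe ye px qy pq ax.
have [s' ay] := lift_scale_exists a ye qy.
have xye : hperp (x + y) e by exact: hperpDl.
have [t] := lift_scale_exists a xye (lift_add xe ye px qy).
have := lift_add (hperpZl a xe) (hperpZl a ye) ax ay.
rewrite -scalerDr [t *: _]scalerDr => sum1 sum2.
by have [-> <-] := lindep2I pq (lift_inj (hperpZl a xye) sum1 sum2).
Qed.

(** The scalar found at [y0] is carried to [x] directly if the lifts are independent, and otherwise
    through a third vector [z]. *)
Lemma lift_scale_uniform a : exists s, forall x p, hperp x e ->
  lift x p -> lift (a *: x) (s *: p).
Proof.
have [q0 q0y] := lift_exists y0e.
have q00 : q0 <> 0.
  by move=> q00; apply: ry0; apply/pspan_eq0; rewrite -(proj1 q0y) q00.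
have [z [t [ze tz q0t]]] := exists_lift_indep q00.
have [s ay] := lift_scale_exists a y0e q0y; exists s => x p xe px.
have az := lift_scale_transfer y0e ze q0y tz q0t ay.
have [p0|p0] := pselect (p = 0).
  have [s' +] := lift_scale_exists a xe px.
  by rewrite p0 !scaler0.
have [q0p|/existsNP[c /contrapT pE]] := pselect (forall c, p <> c *: q0).
  by apply: (lift_scale_transfer y0e xe q0y px _ ay); exact: lindep2P.
apply: (lift_scale_transfer ze xe tz px _ az); apply: lindep2C.
by rewrite pE; apply: lindep2Zl; rewrite -?pE.
Qed.

Theorem projective_map_semilinear :
  exists (sigma : {rmorphism F1 -> F2}) (phi : H1 -> H2),
  [/\ forall u v, phi (u + v) = phi u + phi v,
      forall a u, phi (a *: u) = sigma a *: phi u &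
      forall u, pspan (phi u) = pspan (r u)].
Proof.
have [sigma sigmaP] := choice lift_scale_uniform.
have /choice[phi0 phi0P] : forall x, exists p, hperp x e -> lift x p.
  by move=> x; have [/lift_exists[p]|] := pselect (hperp x e);
     [exists p | exists 0].
have [q qy] := lift_exists y0e.
have q0 : q <> 0.
  by move=> q0; apply: ry0; apply/pspan_eq0; rewrite -(proj1 qy) q0.
have sigmaI a b : lift (a *: y0) (b *: q) -> sigma a = b.
  move=> ab; apply: (sfield_scalerIl q0).
  exact: lift_inj (hperpZl a y0e) (sigmaP _ _ _ y0e qy) ab.
have sigmaD a b : sigma (a + b) = sigma a + sigma b.
  apply: sigmaI; rewrite !scalerDl; apply: lift_add; rewrite ?sigmaP //;
    try exact: hperpZl; exact: sigmaP.
have sigma1 : sigma 1 = 1 by apply: sigmaI; rewrite !scale1r.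
have sigmaM a b : sigma (a * b) = sigma a * sigma b.
  apply: sigmaI; rewrite -!scalerA; apply: (sigmaP); first exact: hperpZl.
  exact: sigmaP.
have sigmaB : GRing.zmod_morphism sigma.
  by move=> a b; rewrite -[in RHS](subrK b a) [in RHS]sigmaD addrK.
pose sM := GRing.isZmodMorphism.Build F1 F2 sigma sigmaB.
pose sMM := GRing.isMonoidMorphism.Build F1 F2 sigma (sigma1, sigmaM).
pose sg : {rmorphism F1 -> F2} := HB.pack sigma sM sMM.
pose c u := hcoef u e; pose x u := u - c u *: e.
have xe u : hperp (x u) e by exact: hperp_hcoef.
have xD u v : x (u + v) = x u + x v.
  by rewrite /x /c hcoefD scalerDl opprD addrACA.
have xZ a u : x (a *: u) = a *: x u.
  by rewrite /x /c hcoefZ scalerBr scalerA.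
have phi0D u v : phi0 (x u + x v) = phi0 (x u) + phi0 (x v).
  have uve : hperp (x u + x v) e by exact: hperpDl.
  by apply: (lift_inj uve (phi0P _ uve)); apply: lift_add; auto.
have phi0Z a u : phi0 (a *: x u) = sigma a *: phi0 (x u).
  have aue : hperp (a *: x u) e by exact: hperpZl.
  by apply: (lift_inj aue (phi0P _ aue)); apply: sigmaP; auto.
exists sg, (fun u => sigma (c u) *: r e + phi0 (x u)); split=> [u v|a u|u] /=.
- by rewrite /c hcoefD -/(c u) -/(c v) xD phi0D sigmaD scalerDl addrACA.
- by rewrite /c hcoefZ -/(c u) xZ phi0Z sigmaM scalerDr scalerA.
have uE : u = c u *: e + x u by rewrite /x addrC subrK.
have [cu|cu] := eqVneq (c u) 0.
  have -> : sigma (c u) = 0 by rewrite cu; exact: (rmorph0 sg).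
  rewrite scale0r add0r (proj1 (phi0P _ (xe u))).
  by rewrite /x cu scale0r subr0.
(* Dividing by [c u] brings [u] to the form [e + x], where the second clause of [lift] applies. *)
have -> : pspan (r u) = pspan (r (e + (c u)^-1 *: x u)).
  rewrite -[RHS](rZ _ cu) scalerDr scalerA mulrV ?sfield_unit // scale1r.
  by rewrite -uE.
have [_ ->] := sigmaP (c u)^-1 _ _ (xe u) (phi0P _ (xe u)).
have scu : sigma (c u) != 0.
  apply/eqP => scu; have := sigmaM (c u) (c u)^-1.
  by rewrite scu mul0r mulrV ?sfield_unit // sigma1 => /eqP; rewrite oner_eq0.
rewrite -[RHS](pspanZ _ scu) scalerDr scalerA -sigmaM mulrV ?sfield_unit //.
by rewrite sigma1 scale1r.
Qed.

End FundamentalTheorem.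

(** * Orthogonal triples from rank at least 3 *)

Section OrthogonalTriple.
Variable X : orthosetType.

Definition orthogonal_triple (x y z : X) :=
  [/\ x <> ozero, y <> ozero & z <> ozero] /\
  [/\ operp x y, operp x z & operp y z].

Lemma rank_ge3_triple : leq_rank 3 (rank X) ->
  exists x y z, orthogonal_triple x y z.
Proof.
move=> rk3; have [n n3 [A [An A0 Aperp]]] :
    exists2 n, (3 <= n)%N & has_orthogonal_family X n.
  move: rk3; rewrite /rank; case: pselect => [[n nmax]|nomax] /=.
    have [xfam _] := xgetI 0%N nmax.
    by exists (xget 0%N (@is_max_orthogonal_size X)).
  (* Infinite rank means that no size is maximal, so every attained size is exceeded by another
     one. *)
  suff unbounded k : exists2 n, (k <= n)%N & has_orthogonal_family X n by [].
  elim: k => [|k [n kn nfam]].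
    by exists 0%N => //; exists set0; split=> //; rewrite II0; exact: card_eq00.
  have [nmax|] := pselect (forall m, has_orthogonal_family X m -> (m <= n)%N).
    by case: nomax; exists n.
  move=> /existsNP[m /not_implyP[mfam /negP]]; rewrite -ltnNge => nm.
  by exists m => //; exact: leq_ltn_trans nm.
have /card_set_bijP[h [_ _ hsurj]] := An.
have [x Ax hx] := hsurj 0%N (leq_trans (isT : (0 < 3)%N) n3).
have [y Ay hy] := hsurj 1%N (leq_trans (isT : (1 < 3)%N) n3).
have [z Az hz] := hsurj 2%N (leq_trans (isT : (2 < 3)%N) n3).
have hperp u v : A u -> A v -> h u <> h v -> operp u v.
  by move=> Au Av huv; apply: Aperp => // uv; apply: huv; rewrite uv.
by exists x, y, z; split; split; try exact: A0; apply: hperp;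
  rewrite ?hx ?hy ?hz.
Qed.

End OrthogonalTriple.

Lemma adjointable0 (X Y : orthosetType) (f : X -> Y) :
  adjointable f -> f ozero = ozero.
Proof. by move=> [g fg]; apply/operp_self/fg; exact: operp0. Qed.

(** * Partial orthometries at the level of vectors *)

Section PartialOrthometry.
Variables (F1 F2 : starSfieldType).
Variables (H1 : orthomodularType F1) (H2 : orthomodularType F2).
Variables (f : projspace H1 -> projspace H2).
Variables (A : osubspace (projspace H1)) (B : osubspace (projspace H2)).
Hypothesis fadj : adjointable f.
Hypothesis fAB : orthoisomorphism_between A B f.
Hypothesis fA : forall p, ocompl A p -> f p = ozero.

Let S1 := [set u | (A : set (projspace H1)) (pspan u)].
Let S2 := [set v | (B : set (projspace H2)) (pspan v)].

Lemma osubspace_decomp u : exists v w, [/\ S1 v, hcompl S1 w & u = v + w].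
Proof.
have [_ /(_ u)[[v w] [[/= ? ? ?] _]]] :=
  orthomodularP _ (osubspace_orthoclosed A).
by exists v, w.
Qed.

(** Since [f] kills [w], adjointness makes [w] orthogonal to every [g q]. Hence both images have the
    same orthocomplement, which determines a line. *)
Lemma orthometry_proj v w : hcompl S1 w -> f (pspan (v + w)) = f (pspan v).
Proof.
move=> Sw; have [g fg] := fadj; apply: ocompl1_inj => q; rewrite !fg.
have fw0 : f (pspan w) = ozero.
  by apply: fA; have : [set u | ocompl A (pspan u)] w by rewrite pspan_ocompl.
have : operp (pspan w) (g q) by apply/fg; rewrite fw0; exact: operp0.
have [t ->] := projE (g q) => /proj_perpE wt.
split=> /proj_perpE vt; apply/proj_perpE; last exact: hperpDl.
by rewrite -[v](addrK w) -scaleN1r; apply/hperpDl/hperpZl.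
Qed.

(** Only [u] has to lie in [S1], because the part of [x] orthogonal to [S1] affects neither side. *)
Lemma orthometry_perp x u : S1 u ->
  operp (f (pspan x)) (f (pspan u)) <-> hperp x u.
Proof.
move=> Su; have [v [w [Sv Sw ->]]] := osubspace_decomp x.
rewrite orthometry_proj // -(proj2 fAB _ _ Sv Su).
have wu : hperp w u by exact: Sw.
split=> [/proj_perpE vu|vu]; first exact: hperpDl.
apply/proj_perpE; rewrite -[v](addrK w) -scaleN1r.
exact/hperpDl/hperpZl.
Qed.

Lemma orthometry_eq0 p : (A : set (projspace H1)) p -> f p = ozero ->
  p = ozero.
Proof.
by move=> Ap fp; apply/operp_self/(proj2 fAB) => //; apply/operp_self.
Qed.

Lemma orthometry_oker : oker f = ocompl A.
Proof.
apply/seteqP; split=> p; last exact: fA.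
have [u ->] := projE p; rewrite /oker /= => fu.
have [v [w [Sv Sw uE]]] := osubspace_decomp u.
move: fu; rewrite uE orthometry_proj // => /(orthometry_eq0 Sv)/pspan_eq0 ->.
rewrite add0r.
by have : [set u | ocompl A (pspan u)] w by rewrite pspan_ocompl.
Qed.

Lemma orthometry_semilinear (e1 e2 e3 : H1) :
    [/\ S1 e1, S1 e2 & S1 e3] -> [/\ e1 <> 0, e2 <> 0 & e3 <> 0] ->
    [/\ hperp e1 e2, hperp e1 e3 & hperp e2 e3] ->
  exists (sigma : {rmorphism F1 -> F2}) (phi : H1 -> H2),
  [/\ forall u v, phi (u + v) = phi u + phi v,
      forall a u, phi (a *: u) = sigma a *: phi u &
      forall u, f (pspan u) = pspan (phi u)].
Proof.
move=> [Se1 Se2 Se3] [e10 e20 e30] [e12 e13 e23].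
have /choice[r rE] : forall u, exists v, f (pspan u) = pspan v.
  by move=> u; exact: projE.
have r_eq0 u : S1 u -> r u = 0 -> u = 0.
  move=> Su ru; apply/pspan_eq0/(orthometry_eq0 Su).
  by rewrite rE; apply/pspan_eq0.
have r_perp u v : S1 u -> hperp v u -> hperp (r v) (r u).
  by move=> Su vu; apply/proj_perpE; rewrite -!rE; apply/orthometry_perp.
have r0 : r 0 = 0.
  by apply/pspan_eq0; rewrite -rE; exact: adjointable0.
have rZ a u : a != 0 -> pspan (r (a *: u)) = pspan (r u).
  by move=> a0; rewrite -!rE pspanZ.
(* This is where the adjoint gives collinearity, by way of [hperp_span2]. *)
have rD u v : exists a b, r (u + v) = a *: r u + b *: r v.
  have [g fg] := fadj; apply: hperp_span2 => t.
  rewrite -!proj_perpE -!rE => /fg + /fg; have [s sE] := projE (g (pspan t)).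
  rewrite sE => /proj_perpE us /proj_perpE vs; apply/fg.
  by rewrite sE; apply/proj_perpE; exact: hperpDl.
have re1 : r e1 <> 0 by move=> /(r_eq0 _ Se1).
have re2 : r e2 <> 0 by move=> /(r_eq0 _ Se2).
have re3 : r e3 <> 0 by move=> /(r_eq0 _ Se3).
have [sigma [phi [phiD phiZ phiE]]] := projective_map_semilinear r0 rZ rD re1
  (fun x => r_perp e1 x Se1) (hperp_sym e12) re2 (hperp_sym e13) re3
  (r_perp _ _ Se3 e23).
by exists sigma, phi; split=> // u; rewrite rE phiE.
Qed.

End PartialOrthometry.

(** * From a semilinear map preserving orthogonality to a partial quasiisometry *)

Section QuasiisometryOfSemilinear.
Variables (F1 F2 : starSfieldType).
Variables (H1 : orthomodularType F1) (H2 : orthomodularType F2).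
Variables (S1 : set H1) (S2 : set H2).
Variables (sigma : {rmorphism F1 -> F2}) (phi : H1 -> H2).
Hypothesis S1c : orthoclosed S1.
Hypothesis S2c : orthoclosed S2.
Hypothesis phiD : forall u v, phi (u + v) = phi u + phi v.
Hypothesis phiZ : forall a u, phi (a *: u) = sigma a *: phi u.
Hypothesis phi_perp : forall x u, S1 u -> hperp (phi x) (phi u) <-> hperp x u.
Hypothesis phi_ker : [set u | phi u = 0] = hcompl S1.
Hypothesis phiS2 : forall u, S2 (phi u).
Hypothesis phi_span : forall v, S2 v ->
  exists2 u, S1 u & pspan v = pspan (phi u).
Variables e1 e2 e3 : H1.
Hypotheses (Se1 : S1 e1) (Se2 : S1 e2) (Se3 : S1 e3).
Hypotheses (e10 : e1 <> 0) (e20 : e2 <> 0) (e30 : e3 <> 0).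
Hypotheses (e12 : hperp e1 e2) (e13 : hperp e1 e3) (e23 : hperp e2 e3).

Let phi0 u : S1 u -> phi u = 0 -> u = 0.
Proof.
move=> Su pu; apply: hform_aniso.
by have : [set u | phi u = 0] u by []; rewrite phi_ker => /(_ u Su).
Qed.

(** The residue of [u] after projection onto [v] is orthogonal to [v], so its image contributes
    nothing. *)
Lemma hform_image u v : S1 v ->
  hform (phi u) (phi v) = sigma (hcoef u v) * hform (phi v) (phi v).
Proof.
move=> Sv; rewrite -{1}[u](subrK (hcoef u v *: v)) phiD phiZ hformDl1 hformZl.
have -> : hform (phi (u - hcoef u v *: v)) (phi v) = 0.
  by apply/phi_perp => //; exact: hperp_hcoef.
by rewrite add0r.
Qed.

(** The value of [lambda] that a nonzero [v] paired with itself demands. *)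
Definition scale_factor v := (sigma (hform v v))^-1 * hform (phi v) (phi v).

Lemma hform_image_factor u v : S1 v ->
  hform (phi u) (phi v) = sigma (hform u v) * scale_factor v.
Proof.
move=> Sv; have [v0|/hform_neq0/sfield_unit v0] := pselect (v = 0).
  have -> : hform (phi u) (phi v) = 0.
    by apply/phi_perp; rewrite // v0; apply/hperpC; exact: hperp0l.
  by rewrite v0 /scale_factor hform0l rmorph0 invr0 mul0r [hform u 0]hperp_sym
    ?rmorph0 ?mul0r //; exact: hperp0l.
by rewrite hform_image // /hcoef rmorphM rmorphV // mulrA.
Qed.

(** Pairing [v] with [v + w] gives the same as pairing [v] with itself, before and after [phi]. *)
Lemma scale_factorD v w : S1 v -> S1 w -> v <> 0 -> hperp v w ->
  scale_factor v = scale_factor (v + w).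
Proof.
move=> Sv Sw v0 vw.
have Svw : S1 (v + w).
  by rewrite -[v]scale1r -[w]scale1r; apply: (proj2 (proj1 S1c)).
have unit_vv : sigma (hform v v) \is a GRing.unit.
  by apply/rmorph_unit/sfield_unit/hform_neq0.
apply: (mulrI unit_vv); rewrite -hform_image_factor //.
have -> : hform v v = hform v (v + w) by rewrite hformDr1 vw addr0.
rewrite -hform_image_factor // phiD hformDr1.
by rewrite (_ : hform (phi v) (phi w) = 0) ?addr0 //; exact/phi_perp.
Qed.

Lemma scale_factor_perp v w : S1 v -> S1 w -> v <> 0 -> w <> 0 -> hperp v w ->
  scale_factor v = scale_factor w.
Proof.
move=> Sv Sw v0 w0 vw; rewrite (scale_factorD Sv Sw) // addrC.
by rewrite -scale_factorD //; exact: hperp_sym.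
Qed.

Lemma scale_factor_const v : S1 v -> v <> 0 -> scale_factor v = scale_factor e1.
Proof.
move=> Sv v0; have [z [Sz z0 zv ze1]] :
    exists z, [/\ S1 z, z <> 0, hperp z v & hperp z e1].
  have [e2v|e2v] := pselect (hperp e2 v).
    by exists e2; split=> //; exact: hperp_sym.
  (* The plane of [e2] and [e3] is orthogonal to [e1]; this combination cancels the pairing with
     [v]. *)
  exists (e3 - (hform e3 v / hform e2 v) *: e2); split.
  - rewrite -scaleNr -[e3]scale1r; exact: (proj2 (proj1 S1c)).
  - move=> z0; apply: e30; apply: hform_aniso.
    move/eqP: z0; rewrite subr_eq0 => /eqP {1}->; exact: hperpZl.
  - by rewrite /hperp hformBl hformZl mulrVK ?subrr // sfield_unit //;
      exact/eqP.
  - by rewrite -scaleNr; apply/hperpDl/hperpZl; exact: hperp_sym.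
rewrite (scale_factor_perp Sv Sz) //; last exact: hperp_sym.
exact: scale_factor_perp.
Qed.

(** The line of [phi e1 + c *: phi e2] is the line of some [phi u]. The components along the
    orthogonal [phi e1] and [phi e2] express [d] and [d * c] as values of [sigma], hence also
    [c]. *)
Lemma scalar_map_surj c : exists a, sigma a = c.
Proof.
have Sv : S2 (phi e1 + c *: phi e2).
  by rewrite -[phi e1]scale1r; apply: (proj2 (proj1 S2c)).
have [u Su /esym/pspanP[d d0 uE]] := phi_span Sv.
have p12 : hperp (phi e1) (phi e2) by exact/phi_perp.
have p1 : hform (phi e1) (phi e1) != 0 by apply: hform_neq0 => /(phi0 Se1).
have p2 : hform (phi e2) (phi e2) != 0 by apply: hform_neq0 => /(phi0 Se2).
have u1 := hform_image u Se1; have u2 := hform_image u Se2.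
rewrite uE hformZl hformDl1 hformZl (hperp_sym p12) mulr0 addr0 in u1.
rewrite uE hformZl hformDl1 hformZl p12 add0r mulrA in u2.
have {u1} dE := mulIr (sfield_unit _ p1) u1.
have {u2} dcE := mulIr (sfield_unit _ p2) u2.
have a0 : hcoef u e1 \is a GRing.unit.
  by apply: sfield_unit; apply: contraNneq d0 => a0; rewrite dE a0 rmorph0.
exists ((hcoef u e1)^-1 * hcoef u e2).
by rewrite rmorphM rmorphV // -dE -dcE mulKr // sfield_unit.
Qed.

Lemma scalar_map_bij : bijective sigma.
Proof.
have [tau tauK] := choice scalar_map_surj; exists tau => // a.
apply/eqP; rewrite -subr_eq0; apply/negPn/negP => /sfield_unit.
by move=> /(rmorph_unit sigma); rewrite rmorphB tauK subrr unitr0.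
Qed.

Theorem semilinear_partial_quasiisometry : partial_quasiisometry phi.
Proof.
exists sigma; first by split=> //; exact: scalar_map_bij.
(* Lines of [S2] are hit by assumption; surjectivity of [sigma] adjusts the scalar so that vectors
   are hit too. *)
have surj v : S2 v -> exists2 u, S1 u & phi u = v.
  move=> Sv; have [u Su /pspan_mem[c ->]] := phi_span Sv.
  have [a <-] := scalar_map_surj c; exists (a *: u); last by rewrite phiZ.
  by rewrite -[a *: u]addr0 -(scale0r u); apply: (proj2 (proj1 S1c)).
exists S1, S2; split=> //.
  apply/seteqP; split=> [_ [u _ <-] //|v /surj[u _ <-]].
  by exists u.
split; last first.
  exists (scale_factor e1).
    apply/eqP => l0; apply: e10; apply: (phi0 Se1); apply: hform_aniso.
    by rewrite hform_image_factor // l0 mulr0.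
  move=> u v _ Sv; rewrite hform_image_factor //.
  have [->|v0] := pselect (v = 0); last by rewrite scale_factor_const.
  by rewrite [hform u 0]hperp_sym ?rmorph0 ?mul0r //; exact: hperp0l.
split=> [u _|u v|v /surj[u Su <-]]; [exact: phiS2| |by exists u].
rewrite !inE => Su Sv /eqP; rewrite -subr_eq0 => /eqP E.
apply/eqP; rewrite -subr_eq0; apply/eqP/phi0.
  by rewrite -scaleN1r -[u]scale1r; apply: (proj2 (proj1 S1c)).
by rewrite -[- v]scaleN1r phiD phiZ rmorphN1 scaleN1r.
Qed.

End QuasiisometryOfSemilinear.

(** * Assembly for partial orthometries *)

Theorem theorem6p6 (F1 F2 : starSfieldType)
  (H1 : orthomodularType F1) (H2 : orthomodularType F2)
  (f : projspace H1 -> projspace H2)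
  (hf : partial_orthometry f)
  (hrank : leq_rank 3 (rank (osub (ocompl_sub (oker f))))) :
  exists2 phi : H1 -> H2, partial_quasiisometry phi &
    forall u : H1, f (pspan u) = pspan (phi u).
Proof.
have [fadj [A [B [fAB fA]]]] := hf.
have [[f_fun _ f_surj] _] := fAB.
have kerE : oker f = ocompl A := orthometry_oker fadj fAB fA.
have [x1 [x2 [x3 [[x10 x20 x30] [x12 x13 x23]]]]] := rank_ge3_triple hrank.
(* The rank concerns the orthocomplement of the kernel, which is [A] because [oker f = ocompl A] and
   [A] is a subspace. *)
have lift_vec (x : osub (ocompl_sub (oker f))) : x <> ozero ->
    exists e, [/\ (A : set _) (pspan e), e <> 0 & sval x = pspan e].
  case: x => p Ap x0; have [e pE] := projE p; exists e; split=> //.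
    by rewrite -pE (osubspaceP A) -kerE.
  move=> e0; apply: x0; apply: eq_sig_hprop => /= [? ? ?|].
    exact: Prop_irrelevance.
  by rewrite pE e0.
have [e1 [Se1 e10 xe1]] := lift_vec _ x10.
have [e2 [Se2 e20 xe2]] := lift_vec _ x20.
have [e3 [Se3 e30 xe3]] := lift_vec _ x30.
have e12 : hperp e1 e2 by apply/proj_perpE; rewrite -xe1 -xe2.
have e13 : hperp e1 e3 by apply/proj_perpE; rewrite -xe1 -xe3.
have e23 : hperp e2 e3 by apply/proj_perpE; rewrite -xe2 -xe3.
have [sigma [phi [phiD phiZ phiE]]] := orthometry_semilinear fadj fAB fA
  (And3 Se1 Se2 Se3) (And3 e10 e20 e30) (And3 e12 e13 e23).
exists phi => //.
apply: (@semilinear_partial_quasiisometry _ _ _ _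
  [set u | (A : set _) (pspan u)] [set v | (B : set _) (pspan v)]
  sigma phi _ _ phiD phiZ _ _ _ _ e1 e2 e3) => //=;
  try exact: osubspace_orthoclosed.
- move=> x u Su; rewrite -proj_perpE -!phiE.
  exact: (orthometry_perp fadj fAB fA).
- rewrite -pspan_ocompl -kerE; apply/seteqP.
  by split=> u /=; rewrite /oker /= phiE => /pspan_eq0.
- move=> u; rewrite -phiE; have [v [w [Sv Sw ->]]] := osubspace_decomp A u.
  by rewrite (orthometry_proj fadj fA) //; exact: f_fun.
move=> v /f_surj[p Ap fpv]; have [u pE] := projE p.
by rewrite pE in Ap fpv; exists u; rewrite // -fpv.
Qed.
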